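(* Let $D=\{0,1\}$ with the order $0<1$. Then the set $\varGamma_{\mathrm{SOF}}$ of all safely OR-free relations on $\{0,1\}$ equals $\mathrm{Inv}(M_{D,\le})$, the set of all relations on $\{0,1\}$ invariant under $M_{D,\le}$.
   Context: For an $r$-ary relation $R$ on $\{0,1\}$ and $0<k<r$, a relation $R'(x_1,\dots,x_{r-k})=R(\xi_1,\dots,\xi_r)$ with each $\xi_j\in\{x_1,\dots,x_{r-k}\}\cup\{0,1\}$ is obtained from $R$ by substitution of constants if each variable occurs at most once among the $\xi_j$, and by identification of variables if every $\xi_j$ is a variable. $R$ is OR-free if $\mathrm{OR}=\{(0,1),(1,0),(1,1)\}$ cannot be obtained from $R$ by substitution of constants; $R$ is safely OR-free if $R$ and every relation obtained from $R$ by identification of variables are OR-free. For a finite totally ordered set $(D,\le)$, $M_{D,\le}$ is the ternary partial operation with $M_{D,\le}(x,y,y)=M_{D,\le}(y,y,x)=x$ whenever $x\le y$, undefined otherwise. A partial operation acts on tuples coordinatewise (defined iff all coordinates are defined); a relation is invariant under it if every defined result of applying it to tuples of the relation lies in the relation.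
   Formalization: OR-free is read to require also that R is not OR itself (the case k = 0 of substitution of constants); with 0<k<r taken literally, OR would be safely OR-free yet not invariant under M, since M((0,1),(1,1),(1,0)) = (0,0). *)

(* Defs.v *)
From HB Require Import structures.
From mathcomp Require Import all_boot all_order.
From mathcomp Require Import classical_sets.

Set Implicit Arguments.
Unset Strict Implicit.
Unset Printing Implicit Defensive.

Definition relation_on (D : finType) (r : nat) := {set r.-tuple D}.

(* Relations of all finite arities, so that sets of relations can be compared. *)
Definition any_relation (D : finType) := {r : nat & relation_on D r}.

Definition mk_relation (D : finType) (r : nat) (R : relation_on D r) :
  any_relation D := existT (relation_on D) r R.

(* An argument xi_j: a variable x_i (inl i) or a constant (inr c). *)
Definition arg (m : nat) := ('I_m + bool)%type.

Definition arg_val (m : nat) (x : m.-tuple bool) (a : arg m) : bool :=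
  match a with
  | inl i => tnth x i
  | inr c => c
  end.

(* R'(x_1, ..., x_m) = R(xi_1, ..., xi_r). *)
Definition specialize (r m : nat) (R : relation_on bool r)
    (xi : 'I_r -> arg m) : relation_on bool m :=
  [set x : m.-tuple bool | [tuple arg_val x (xi j) | j < r] \in R]%SET.

(* The arity of R' is m = r - k, so 0 < k < r reads 0 < m < r. *)
Definition by_substitution (r m : nat) (R : relation_on bool r)
    (R' : relation_on bool m) : Prop :=
  0 < m < r /\
  exists xi : 'I_r -> arg m,
    (forall (i : 'I_m) (j1 j2 : 'I_r),
        xi j1 = inl i -> xi j2 = inl i -> j1 = j2) /\
    R' = specialize R xi.

Definition by_identification (r m : nat) (R : relation_on bool r)
    (R' : relation_on bool m) : Prop :=
  0 < m < r /\
  exists xi : 'I_r -> arg m,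
    (forall j : 'I_r, exists i : 'I_m, xi j = inl i) /\
    R' = specialize R xi.

Definition OR : relation_on bool 2 :=
  [set [tuple false; true]; [tuple true; false]; [tuple true; true]]%SET.

(* by_substitution replaces at least one variable (k > 0), hence never yields
   a relation of the same arity; the first conjunct is the case k = 0, so that
   OR itself is not OR-free. *)
Definition or_free (r : nat) (R : relation_on bool r) : Prop :=
  mk_relation R <> mk_relation OR /\ ~ by_substitution R OR.

Definition safely_or_free (r : nat) (R : relation_on bool r) : Prop :=
  or_free R /\
  forall (m : nat) (R' : relation_on bool m),
    by_identification R R' -> or_free R'.

Definition Gamma_SOF : set (any_relation bool) :=
  fun R => safely_or_free (projT2 R).

Definition partial_op3 (D : Type) := D -> D -> D -> option D.

Definition invariant_under (D : finType) (f : partial_op3 D) (r : nat)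
    (R : relation_on D r) : Prop :=
  forall a b c t : r.-tuple D,
    a \in R -> b \in R -> c \in R ->
    (forall i : 'I_r, f (tnth a i) (tnth b i) (tnth c i) = Some (tnth t i)) ->
    t \in R.

Definition Inv (D : finType) (f : partial_op3 D) : set (any_relation D) :=
  fun R => invariant_under f (projT2 R).

(* M(x, y, y) = M(y, y, x) = x for x <= y; the two clauses agree where they
   overlap, at (x, x, x). *)
Definition M_op (d : Order.disp_t) (D : finOrderType d) : partial_op3 D :=
  fun x y z =>
    if (y == z) && (x <= y)%O then Some x
    else if (x == y) && (z <= y)%O then Some z
    else None.

(* Main.v *)
Require Import Defs.
From HB Require Import structures.
From mathcomp Require Import all_boot all_order.
From mathcomp Require Import classical_sets.
From mathcomp Require Import boolp.

Set Implicit Arguments.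
Unset Strict Implicit.
Unset Printing Implicit Defensive.

(** On {0,1}, M(a, b, c) is defined exactly when b = a \/ c, and then equals
    a /\ c. If R contains a, c and a \/ c but not a /\ c, label each coordinate
    by the pair of its values in a and c: reading (0,0) and (1,1) as constants
    and (0,1), (1,0) as two variables specializes R to OR. Such a mixed
    specialization factors through the set of labels used, as an identification
    of variables followed by a substitution of constants. Conversely,
    invariance is inherited by every specialization, and OR is not invariant. *)

Lemma M_op_boolP (x y z t : bool) :
  M_op x y z = Some t <-> y = x || z /\ t = x && z.
Proof. by case: x; case: y; case: z; case: t; split=> // -[]. Qed.

Lemma in_OR (x : 2.-tuple bool) :
  (x \in OR) = tnth x ord0 || tnth x ord_max.
Proof.
rewrite !inE -!val_eqE /= !(tnth_nth false) /=.
by case: x => -[|[] [|[] []]].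
Qed.

Lemma ord2P (i : 'I_2) : i = ord0 \/ i = ord_max.
Proof. by case: i => -[|[]] // lt_i; [left | right]; apply: val_inj. Qed.

Lemma specialize_comp (r m n : nat) (R : relation_on bool r)
    (zeta : 'I_r -> 'I_m) (eta : 'I_m -> arg n) :
  specialize (specialize R (fun j => inl (zeta j))) eta =
  specialize R (fun j => eta (zeta j)).
Proof.
apply/setP => x; rewrite !inE; congr (_ \in R).
by apply: eq_from_tnth => j; rewrite !tnth_mktuple /= tnth_mktuple.
Qed.

Lemma invariant_specialize (r m : nat) (R : relation_on bool r)
    (xi : 'I_r -> arg m) :
  invariant_under (M_op (D := bool)) R ->
  invariant_under (M_op (D := bool)) (specialize R xi).
Proof.
move=> invR a b c t; rewrite !inE => Ra Rb Rc Mabc.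
apply: invR Ra Rb Rc _ => j; rewrite !tnth_mktuple.
(* Constants are harmless because M(c, c, c) = c. *)
by case: (xi j) => [i|[]] //=; apply: Mabc.
Qed.

Lemma OR_not_invariant : ~ invariant_under (M_op (D := bool)) OR.
Proof.
move=> /(_ [tuple false; true] [tuple true; true] [tuple true; false]
           [tuple false; false]).
rewrite !in_OR => /(_ isT isT isT) H.
suff: false by [].
by apply: H => i; case: (ord2P i) => ->.
Qed.

Lemma invariant_or_free (r : nat) (R : relation_on bool r) :
  invariant_under (M_op (D := bool)) R -> or_free R.
Proof.
move=> invR; split=> [eqR | [_ [xi [_ eqOR]]]]; apply: OR_not_invariant.
  (* Phrasing invariance through [Inv] puts it on the dependent pair, where [eqR] can rewrite. *)
  have: Inv (M_op (D := bool)) (mk_relation R) by [].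
  by rewrite eqR.
by rewrite eqOR; apply: invariant_specialize.
Qed.

Lemma OR_specialize_var (r : nat) (R : relation_on bool r)
    (xi : 'I_r -> arg 2) (i : 'I_2) :
  OR = specialize R xi -> exists j, xi j = inl i.
Proof.
move=> eqOR.
suff /existsP[j /eqP]: [exists j, xi j == inl i] by exists j.
apply: contraT; rewrite negb_exists => /forallP xi_i.
(* These tuples differ only at [i], yet [OR] separates them. *)
pose x := [tuple i == k | k < 2]; pose y := [tuple false | k < 2].
have: (x \in OR) = (y \in OR).
  rewrite eqOR !inE; congr (_ \in R); apply: eq_from_tnth => j.
  rewrite !tnth_mktuple; case eq_xi: (xi j) => [k|//] /=.
  rewrite !tnth_mktuple; apply: contraNF (xi_i j) => /eqP ->.
  by rewrite eq_xi.
by rewrite !in_OR !tnth_mktuple; case: (ord2P i) => ->.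
Qed.

(** Injectivity makes [eta] a legal substitution when m > 2. When m = 2, both variables occur, so
    [eta] merely permutes them; as [OR] is symmetric, [R] is [OR] itself. *)
Lemma injective_specialize_OR (m : nat) (R : relation_on bool m)
    (eta : 'I_m -> arg 2) :
  injective eta -> OR = specialize R eta -> ~ or_free R.
Proof.
move=> eta_inj eqOR [RnOR nsub].
have [j0 eta0] := OR_specialize_var ord0 eqOR.
have [j1 eta1] := OR_specialize_var ord_max eqOR.
have neq_j : j0 != j1 by apply: contra_eqN eta0 => /eqP ->; rewrite eta1.
have gt1m : 1 < m.
  rewrite -[m]card_ord; apply/card_gt1P.
  by exists j0, j1.
have [gt2m | le2m] := ltnP 2 m.
  apply: nsub; split; first by rewrite gt2m.
  exists eta; split=> // i j k eq_j eq_k; apply: eta_inj.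
  by rewrite eq_j eq_k.
have eqm : m = 2 by apply/eqP; rewrite eqn_leq le2m.
subst m.
apply: RnOR; congr (mk_relation _); apply/setP => x.
(* [y] undoes the permutation: reading it through [eta] gives back [x]. *)
pose y := [tuple tnth x j0; tnth x j1].
have ->: x = [tuple arg_val y (eta j) | j < 2].
  apply: eq_from_tnth => j; rewrite tnth_mktuple.
  suff [-> | ->]: j = j0 \/ j = j1 by rewrite ?eta0 ?eta1.
  by move: neq_j; case: (ord2P j) => ->; case: (ord2P j0) => ->;
     case: (ord2P j1) => ->; auto.
transitivity (y \in OR); first by rewrite eqOR inE.
rewrite !in_OR !tnth_mktuple; move: neq_j eta0 eta1.
case: (ord2P j0) => ->; case: (ord2P j1) => -> // _ -> -> //=.
by rewrite orbC.
Qed.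

Lemma specialize_OR_not_safe (r : nat) (R : relation_on bool r)
    (xi : 'I_r -> arg 2) :
  OR = specialize R xi -> ~ safely_or_free R.
Proof.
move=> eqOR [Rfree idfree].
have [/injectiveP xi_inj | xi_ninj] := boolP (injectiveb xi).
  exact: injective_specialize_OR xi_inj eqOR Rfree.
pose A := [set xi j | j in 'I_r]%SET.
have xiA j : xi j \in A by apply: imset_f.
(* [j0] only shows that [A] is nonempty, as [enum_rank_in] requires. *)
have [j0 _] := OR_specialize_var ord0 eqOR.
pose zeta j := enum_rank_in (xiA j0) (xi j).
have zetaK j : enum_val (zeta j) = xi j by rewrite enum_rankK_in.
apply: (@injective_specialize_OR #|A| (specialize R (fun j => inl (zeta j)))
          (fun i => enum_val i)).
- exact: enum_val_inj.
- rewrite specialize_comp eqOR; congr (specialize R _).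
  by apply: funext => j; rewrite zetaK.
apply: idfree; split; last by exists (fun j => inl (zeta j)); split=> // j; exists (zeta j).
apply/andP; split; first by apply/card_gt0P; exists (xi j0).
(* An identification must lower the arity; the image of the non-injective [xi] has fewer than [r]
   labels. *)
rewrite -[X in _ < X]card_ord ltn_neqAle leq_imset_card andbT.
by apply: contra xi_ninj => /imset_injP inj; apply/injectiveP => i j; apply: inj.
Qed.

Lemma safely_or_free_invariant (r : nat) (R : relation_on bool r) :
  safely_or_free R -> invariant_under (M_op (D := bool)) R.
Proof.
move=> safeR a b c t Ra Rb Rc Mabc; apply: contraT => Rt.
pose xi (j : 'I_r) : arg 2 :=
  if tnth a j == tnth c j then inr (tnth a j)
  else inl (if tnth a j then ord_max else ord0).
case: (@specialize_OR_not_safe _ R xi) => //; apply/setP => x.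
rewrite in_OR inE.
(* The variable [ord_max] marks the coordinates where only [a] is 1, [ord0] those where only [c] is.
   So (0,1) yields [a], (1,0) yields [c], (1,1) their join [b], and (0,0) their meet [t]. *)
pose u := if tnth x ord0 then (if tnth x ord_max then b else c)
          else if tnth x ord_max then a else t.
have ->: [tuple arg_val x (xi j) | j < r] = u.
  apply: eq_from_tnth => j; rewrite tnth_mktuple /xi /u.
  have /M_op_boolP[] := Mabc j.
  case x0: (tnth x ord0); case x1: (tnth x ord_max);
  by case: (tnth a j); case: (tnth c j) => /= bj tj; rewrite ?bj ?tj ?x0 ?x1.
rewrite /u; case: (tnth x ord0); case: (tnth x ord_max) => //=.
by rewrite (negbTE Rt).
Qed.

(* The library order on bool is false < true, i.e. 0 < 1. *)
Theorem theorem39 : Gamma_SOF = Inv (D := bool) (M_op (D := bool)).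
Proof.
apply: funext => -[r R]; apply: propext; split=> [|invR].
  exact: safely_or_free_invariant.
split=> [|m R' [_ [xi [_ ->]]]]; first exact: invariant_or_free.
by apply: invariant_or_free; apply: invariant_specialize.
Qed.
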